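(* Let $\mathcal{I}=\{I_i\}$ be a (finite) generating set of the $O(n)$-invariant polynomials on $\mathcal{T}_n$. Let $\mathcal{R}\subset\mathcal{T}_n$ be a set of tensors, specified in terms of $r$ real parameters $v_1,\dots,v_r$, and let $\mathcal{S}=\{\sigma\circ R:\ R\in\mathcal{R},\ \sigma\in O(n)\}$ be the union of the $O(n)$ orbits of the elements of $\mathcal{R}$. Let $\mathcal{J}=\{q_j\}$ be a (finite) generating set of the polynomial invariants of the action of the stabilizer $G_{\mathcal{R}}$ on $\mathcal{R}$. Suppose that there are an $O(n)$-invariant set $\widetilde{\mathcal{T}}$ with $\mathcal{S}\subset\widetilde{\mathcal{T}}\subset\mathcal{T}_n$ and $O(n)$-invariant functions $\widetilde{\mathcal{J}}=\{\widetilde q_j\}$, $\widetilde q_j:\widetilde{\mathcal{T}}\to\mathbb{R}$, with $\widetilde q_j|_{\mathcal{R}}=q_j$ for all $j=1,\dots,|\mathcal{J}|$. For each $i$ let $F_i$ be a polynomial such that $I_i=F_i(\{q_j\})$ on $\mathcal{R}$ (such polynomials exist, since each $I_i|_{\mathcal{R}}$ is $G_{\mathcal{R}}$-invariant). Then, for $\Gamma\in\mathcal{T}_n$, we have $\Gamma\in\mathcal{S}$ if and only if both of the following hold: (1) $\Gamma\in\widetilde{\mathcal{T}}$ and $I_i(\Gamma)=F_i(\{\widetilde q_j(\Gamma)\})$ for all $i=1,\dots,|\mathcal{I}|$; (2) (solvability) there is $R\in\mathcal{R}$ such that $\widetilde q_j(\Gamma)=\widetilde q_j(R)$ for all $j=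1,\dots,|\mathcal{J}|$.
   Context: $\mathcal{T}_n$ is the real vector space of real $n\times n\times n$ tensors $\Gamma=(\Gamma^i_{jk})$ that are trilinear (completely symmetric), i.e. $\Gamma^i_{jk}=\Gamma^i_{kj}=\Gamma^j_{ik}$. The group $O(n)$ acts on $\mathcal{T}_n$ by $(\sigma\circ\Gamma)^i_{jk}=\sum_{i',j',k'}\sigma_{ii'}\sigma_{jj'}\sigma_{kk'}\Gamma^{i'}_{j'k'}$. A real-valued function $I$ on an $O(n)$-invariant subset of $\mathcal{T}_n$ is $O(n)$-invariant if $I(\sigma\circ\Gamma)=I(\Gamma)$ for all $\sigma\in O(n)$. A generating set of the $O(n)$-invariant polynomials is a finite set of $O(n)$-invariant polynomials (in the entries of $\Gamma$) such that every $O(n)$-invariant polynomial on $\mathcal{T}_n$ is a polynomial in its members. The stabilizer subgroup of $\mathcal{R}$ is $G_{\mathcal{R}}=\{g\in O(n): g\circ R\in\mathcal{R}\text{ for all }R\in\mathcal{R}\}$. A polynomial invariant of $G_{\mathcal{R}}$ on $\mathcal{R}$ is a polynomial function $q$ on $\mathcal{R}$ (polynomial in the entries of the tensors in $\mathcal{R}$) with $q(g\circ R)=q(R)$ for all $g\in G_{\mathcal{R}}$, $R\in\mathcal{R}$; a generating set of these is a finite set of such invariants such that every such invariant is a polynomial in its members. The functions $\widetilde q_j$ need not be polynomial. *)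

(* Defs.v *)
(* [mpoly] is required without being imported: its notations clash with those
   of MathComp-Analysis. *)
From mathcomp Require Import all_boot all_order all_algebra.
From mathcomp Require Import boolp classical_sets reals.
From mathcomp Require mpoly.

Set Implicit Arguments.
Unset Strict Implicit.
Unset Printing Implicit Defensive.

Import GRing.Theory.
Local Open Scope ring_scope.
Local Open Scope classical_set_scope.

(* The entry Gamma^i_{jk} is [G (i, j, k)]. *)
Definition tensor (R : realType) (n : nat) : Type :=
  {ffun 'I_n * 'I_n * 'I_n -> R}.

Definition symTensor (R : realType) (n : nat) : set (tensor R n) :=
  [set G | forall i j k : 'I_n,
     G (i, j, k) = G (i, k, j) /\ G (i, j, k) = G (j, i, k)].

Definition orthogonalGroup (R : realType) (n : nat) : set 'M[R]_n :=
  [set s | s *m s^T = 1%:M].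

Definition act (R : realType) (n : nat) (s : 'M[R]_n) (G : tensor R n) :
    tensor R n :=
  [ffun t : 'I_n * 'I_n * 'I_n => let: (i, j, k) := t in
     \sum_(i' < n) \sum_(j' < n) \sum_(k' < n)
       s i i' * s j j' * s k k' * G (i', j', k')].

Definition stabilizer (R : realType) (n : nat) (A : set (tensor R n)) :
    set 'M[R]_n :=
  [set g | orthogonalGroup g /\ forall G, A G -> A (act g G)].

Definition orbitUnion (R : realType) (n : nat) (A : set (tensor R n)) :
    set (tensor R n) :=
  [set G | exists s G0, [/\ orthogonalGroup s, A G0 & G = act s G0]].

Definition invariantSet (R : realType) (n : nat) (A : set (tensor R n)) :
    Prop :=
  forall s G, orthogonalGroup s -> A G -> A (act s G).

(* A function on a subset [A] of the tensors is represented by a total function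
   of which only the values on [A] matter. *)
Definition invariantOn (R : realType) (n : nat) (H : set 'M[R]_n)
    (A : set (tensor R n)) (f : tensor R n -> R) : Prop :=
  forall s G, H s -> A G -> f (act s G) = f G.

(* One indeterminate for each of the n^3 entries; on symmetric tensors this
   gives the same functions as one indeterminate per independent entry. *)
Definition polynomialOn (R : realType) (n : nat) (A : set (tensor R n))
    (f : tensor R n -> R) : Prop :=
  exists p : mpoly.mpoly #|{: 'I_n * 'I_n * 'I_n}| R,
    forall G, A G -> f G = mpoly.meval (fun t => G (enum_val t)) p.

Definition polynomialInvariantOn (R : realType) (n : nat) (H : set 'M[R]_n)
    (A : set (tensor R n)) (f : tensor R n -> R) : Prop :=
  polynomialOn A f /\ invariantOn H A f.

Definition generatingFamily (R : realType) (n : nat) (H : set 'M[R]_n)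
    (A : set (tensor R n)) (m : nat) (f : 'I_m -> tensor R n -> R) : Prop :=
  (forall i, polynomialInvariantOn H A (f i)) /\
  forall g, polynomialInvariantOn H A g ->
    exists P : mpoly.mpoly m R,
      forall G, A G -> g G = mpoly.meval (fun i => f i G) P.

(* Main.v *)
(* Polynomial invariants separate the orbits of the compact group O(n), so two
   symmetric tensors on which all the I_i agree lie in one orbit; conditions (1)
   and (2) say exactly that all the I_i agree at Gamma and at some R in A.

   Separation without Haar measure: given two disjoint orbits, a sum of even
   powers of linear forms is larger on one orbit than on the other, with a gap.
   The coefficient vectors, in a tensor power of the space of tensors, of the
   homogeneous polynomials with such a gap form a nonempty closed convex set
   stable under the isometric action of O(n). Its unique element of minimal norm
   is fixed by O(n), hence is the coefficient vector of an invariant. *)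
Require Import Defs.
From HB Require Import structures.
From mathcomp Require Import all_boot all_order all_algebra.
From mathcomp Require Import boolp classical_sets reals.
From mathcomp Require Import topology normedtype sequences derive.
From mathcomp Require Import ring lra finmap.
From mathcomp Require mpoly.
Import (canonicals) mpoly.

Set Implicit Arguments.
Unset Strict Implicit.
Unset Printing Implicit Defensive.

Import Order.TTheory GRing.Theory Num.Theory.
Import numFieldNormedType.Exports.
Local Open Scope ring_scope.
Local Open Scope classical_set_scope.
Import ArrowAsProduct.

(** * Inner products and linear maps on functions over a finite index type *)

Definition dot (R : realType) (K : finType) (x y : K -> R) : R :=
  \sum_k x k * y k.

(** Matrices are plain kernels [K -> K -> R], so that triples of indices and multi-indices
    [{ffun 'I_d -> K}] can serve as index types without enumeration. *)
Definition app (R : realType) (K : finType) (g : K -> K -> R) (x : K -> R) :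
    K -> R :=
  fun a => \sum_b g a b * x b.

Definition transpose (R : realType) (K : finType) (g : K -> K -> R) :
    K -> K -> R :=
  fun a b => g b a.

Definition orthogonalKernel (R : realType) (K : finType) (g : K -> K -> R) :
    Prop :=
  forall a b, dot (g a) (g b) = (a == b)%:R.

(** As [w] varies, [dot w (tensorPower x)] runs through the homogeneous polynomials of degree [d] in
    the entries of [x]. *)
Definition tensorPower (R : realType) (K : finType) (d : nat) (x : K -> R) :
    {ffun 'I_d -> K} -> R :=
  fun phi => \prod_i x (phi i).

Definition kernelPower (R : realType) (K : finType) (d : nat)
    (g : K -> K -> R) : {ffun 'I_d -> K} -> {ffun 'I_d -> K} -> R :=
  fun phi psi => \prod_i g (phi i) (psi i).

Section InnerProduct.
Variables (R : realType) (K : finType).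
Implicit Types (x y z : K -> R) (g h : K -> K -> R).

Lemma dotC x y : dot x y = dot y x.
Proof. by apply: eq_bigr => k _; rewrite mulrC. Qed.

Lemma dot_ge0 x : 0 <= dot x x.
Proof. by apply: sumr_ge0 => k _; rewrite -expr2 sqr_ge0. Qed.

Lemma dot_le0_eq0 x : dot x x <= 0 -> forall k, x k = 0.
Proof.
move=> x0 k; have /eqP : dot x x = 0 by apply/eqP; rewrite eq_le x0 dot_ge0.
rewrite psumr_eq0 => [/allP /(_ k (mem_index_enum _))|j _].
  by rewrite /= mulf_eq0 orbb => /eqP.
by rewrite -expr2 sqr_ge0.
Qed.

Lemma dot_subsq x y :
  dot (fun k => x k - y k) (fun k => x k - y k)
  = dot x x + dot y y - 2 * dot x y.
Proof.
rewrite /dot mulr_sumr -big_split/= -sumrB; apply: eq_bigr => k _; ring.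
Qed.

Lemma dot_midpoint x y z :
  dot (fun k => (x k + y k) / 2) z = (dot x z + dot y z) / 2.
Proof.
rewrite /dot -big_split/= mulr_suml; apply: eq_bigr => k _; ring.
Qed.

Lemma dot_midpoint_sq x y :
  dot (fun k => (x k + y k) / 2) (fun k => (x k + y k) / 2)
  = (dot x x + dot y y + 2 * dot x y) / 4.
Proof.
rewrite /dot mulr_sumr -!big_split/= mulr_suml; apply: eq_bigr => k _; lra.
Qed.

Lemma dot_app g x y : dot (app g x) y = dot x (app (transpose g) y).
Proof.
rewrite /dot /app; under eq_bigr do rewrite mulr_suml.
rewrite exchange_big; apply: eq_bigr => a _; rewrite mulr_sumr.
by apply: eq_bigr => b _; rewrite /transpose; ring.
Qed.

Lemma app_app g h x :
  app g (app h x) = app (fun a b => \sum_c g a c * h c b) x.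
Proof.
apply: funext => a; rewrite /app; under eq_bigr do rewrite mulr_sumr.
rewrite exchange_big; apply: eq_bigr => b _; rewrite mulr_suml.
by apply: eq_bigr => c _; rewrite mulrA.
Qed.

Lemma app_delta x : app (fun a b => (a == b)%:R) x = x.
Proof.
apply: funext => a; rewrite /app (bigD1 a)//= eqxx mul1r big1 ?addr0// => b ba.
by rewrite eq_sym (negbTE ba) mul0r.
Qed.

Lemma app_transposeK g x :
  orthogonalKernel g -> app g (app (transpose g) x) = x.
Proof.
move=> og; rewrite app_app -[RHS]app_delta; congr (app _ x).
by apply: funext => a; apply: funext => b; rewrite -og.
Qed.

End InnerProduct.

(** * Tensor powers of vectors and of kernels *)

Section TensorPower.
Variables (R : realType) (K : finType) (d : nat).
Implicit Types (x y : K -> R) (g : K -> K -> R).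

(** Distributivity turns a power of a sum into a sum over multi-indices. Hence powers of linear
    forms have tensor powers as coefficient vectors. *)
Lemma dot_tensorPower x y :
  dot (tensorPower (d := d) x) (tensorPower y) = dot x y ^+ d.
Proof.
rewrite /dot -[d in RHS]card_ord -prodr_const bigA_distr_bigA/=.
by apply: eq_bigr => phi _; rewrite -big_split.
Qed.

Lemma app_tensorPower g x :
  app (kernelPower g) (tensorPower (d := d) x) = tensorPower (app g x).
Proof.
apply: funext => phi; rewrite /tensorPower /app bigA_distr_bigA/=.
by apply: eq_bigr => psi _; rewrite -big_split.
Qed.

Lemma kernelPower_transpose g :
  transpose (kernelPower (d := d) g) = kernelPower (transpose g).
Proof. by []. Qed.

(** The inner product of two rows factors over the [d] positions, and distinct multi-indices differ
    at some position, where the factor vanishes. *)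
Lemma kernelPower_orthogonal g :
  orthogonalKernel g -> orthogonalKernel (kernelPower (d := d) g).
Proof.
move=> og phi psi.
transitivity (\prod_(i < d) dot (g (phi i)) (g (psi i))).
  rewrite bigA_distr_bigA/=; apply: eq_bigr => chi _.
  by rewrite /kernelPower -big_split.
have [->|/eqP neq] := eqVneq phi psi.
  by rewrite big1// => i _; rewrite og eqxx.
have [i neqi] : exists i, phi i != psi i.
  apply: contra_notP neq => /forallNP eqi; apply/ffunP => i.
  by apply/eqP; apply: contrapT => /negP; exact: eqi.
by rewrite (bigD1 i)//= og (negbTE neqi) mul0r.
Qed.

End TensorPower.

(** * Compactness, and vectors of minimal norm in closed convex sets *)

Section MinimalNorm.
Variables (R : realType) (K : finType).

Lemma coordinate_continuous (k : K) : continuous (fun x : K -> R => x k).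
Proof. exact: (@proj_continuous K (fun=> R) k). Qed.

Lemma sum_continuous (T : topologicalType) (I : finType) (f : I -> T -> R) :
  (forall i, continuous (f i)) -> continuous (fun t => \sum_i f i t).
Proof. by move=> fc; apply: continuous_big => // t; exact: add_continuous. Qed.

Lemma mul_fun_continuous (T : topologicalType) (f g : T -> R) :
  continuous f -> continuous g -> continuous (fun t => f t * g t).
Proof. by move=> fc gc t; apply: cvgM; [exact: fc|exact: gc]. Qed.

Lemma dot_continuous (y : K -> R) : continuous (fun x : K -> R => dot x y).
Proof.
apply: sum_continuous => k; apply: mul_fun_continuous.
  exact: coordinate_continuous.
exact: cst_continuous.
Qed.

Lemma sqnorm_continuous : continuous (fun x : K -> R => dot x x).
Proof.
apply: sum_continuous => k.
by apply: mul_fun_continuous; exact: coordinate_continuous.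
Qed.

Lemma closed_halfspace_ge (y : K -> R) (b : R) :
  closed [set x : K -> R | b <= dot x y].
Proof.
apply: (@closed_comp _ _ (fun x : K -> R => dot x y) [set t | b <= t]).
  by move=> x _; exact: dot_continuous.
exact: closed_ge.
Qed.

Lemma closed_halfspace_le (y : K -> R) (b : R) :
  closed [set x : K -> R | dot x y <= b].
Proof.
apply: (@closed_comp _ _ (fun x : K -> R => dot x y) [set t | t <= b]).
  by move=> x _; exact: dot_continuous.
exact: closed_le.
Qed.

Lemma cube_compact (M : R) :
  compact [set x : K -> R | forall k, `[- M, M] (x k)].
Proof.
apply: (@tychonoff K (fun=> R) (fun=> `[- M, M])) => k.
exact: segment_compact.
Qed.

(** [compact_cover] speaks of pointed spaces, so the function space is given the zero function as
    base point. *)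
Lemma fun_compact_cover (A : set (K -> R)) : compact A -> cover_compact A.
Proof.
pose T : ptopologicalType := HB.pack (prod_topology (fun _ : K => R))
  (isPointed.Build (prod_topology (fun _ : K => R)) (fun=> 0)).
by have /(congr1 (fun F => F A)) -> := @compact_cover T.
Qed.

Lemma exists_min_norm (C : set (K -> R)) :
  C !=set0 -> closed C ->
  exists2 w, C w & forall v, C v -> dot w w <= dot v v.
Proof.
move=> [w0 Cw0] closedC.
pose B := C `&` [set w | dot w w <= dot w0 w0].
have compactB : compact B.
  (* The bound comes from [t * t <= c] implying [|t| <= 1 + c], which avoids square roots. *)
  apply: subclosed_compact _ (@cube_compact (1 + dot w0 w0)) _.
    apply: closedI => //.
    apply: (@closed_comp _ _ (fun x : K -> R => dot x x)
              [set t | t <= dot w0 w0]); last exact: closed_le.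
    by move=> x _; exact: sqnorm_continuous.
  move=> w [_ /= wle] k; rewrite /= in_itv/= -ler_norml.
  have : w k * w k <= dot w0 w0.
    apply: le_trans wle; rewrite /dot (bigD1 k)//= lerDl.
    by apply: sumr_ge0 => j _; rewrite -expr2 sqr_ge0.
  by move: (dot_ge0 w0); rewrite ler_norml; nra.
have B0 : B !=set0 by exists w0; split => /=.
have cB : {within B, continuous (fun x : K -> R => dot x x)}.
  by apply: continuous_subspaceT => x; exact: sqnorm_continuous.
have [w] := compact_EVT_min B0 compactB cB.
move=> /set_mem[Cw /= wle] wmin; exists w => // v Cv.
have [vle|/ltW] := leP (dot v v) (dot w0 w0); last first.
  exact: le_trans.
by apply: wmin; apply/mem_set.
Qed.

(** A vector [w] of minimal norm is unique: [app g w] lies in [C] with the same norm, and if it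
    differed from [w], their midpoint would be strictly shorter. *)
Lemma exists_fixed_vector (C : set (K -> R)) :
  C !=set0 -> closed C ->
  (forall x y, C x -> C y -> C (fun k => (x k + y k) / 2)) ->
  exists2 w, C w & forall g, orthogonalKernel (transpose g) ->
    (forall v, C v -> C (app g v)) -> app g w = w.
Proof.
move=> C0 closedC midC; have [w Cw wmin] := exists_min_norm C0 closedC.
exists w => // g og gC; set v := app g w.
have vw : dot v v = dot w w.
  by rewrite {1}/v dot_app (_ : app _ v = w)//; exact: (app_transposeK w og).
have := wmin _ (midC _ _ Cw (gC _ Cw)); rewrite -/v dot_midpoint_sq vw => mid_ge.
have dist0 : dot (fun k => v k - w k) (fun k => v k - w k) <= 0.
  by rewrite dot_subsq vw (dotC v w); lra.
apply: funext => k; apply/eqP; rewrite -subr_eq0.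
exact/eqP/(dot_le0_eq0 dist0).
Qed.

End MinimalNorm.

(** * The action of O(n) on tensors and the separation of its orbits *)

Notation triple n := ('I_n * 'I_n * 'I_n)%type.

(** The third Kronecker power of [s], which is the matrix of [act s]. *)
Definition tripleKernel (R : realType) (n : nat) (s : 'M[R]_n)
    (a b : triple n) : R :=
  s a.1.1 b.1.1 * s a.1.2 b.1.2 * s a.2 b.2.

Section OrthogonalAction.
Variables (R : realType) (n : nat).
Implicit Types (s t : 'M[R]_n) (x y : tensor R n).

Lemma sum_triple (F : 'I_n -> 'I_n -> 'I_n -> R) :
  \sum_(b : triple n) F b.1.1 b.1.2 b.2 = \sum_i \sum_j \sum_k F i j k.
Proof. by rewrite pair_bigA pair_bigA. Qed.

Lemma actE s x : (act s x : triple n -> R) = app (tripleKernel s) x.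
Proof.
apply: funext => -[[i j] k]; rewrite ffunE /app /tripleKernel /=.
rewrite -(sum_triple (fun i' j' k' =>
  s i i' * s j j' * s k k' * x (i', j', k'))).
by apply: eq_bigr => -[[]].
Qed.

Lemma tripleKernel_mul s t (a b : triple n) :
  \sum_c tripleKernel s a c * tripleKernel t c b = tripleKernel (s *m t) a b.
Proof.
rewrite /tripleKernel (sum_triple (fun i j k =>
  s a.1.1 i * s a.1.2 j * s a.2 k * (t i b.1.1 * t j b.1.2 * t k b.2))).
rewrite !mxE !mulr_suml; apply: eq_bigr => i _.
rewrite -mulrA mulr_suml mulr_sumr; apply: eq_bigr => j _.
rewrite !mulr_sumr; apply: eq_bigr => k _; ring.
Qed.

Lemma tripleKernel_tr s : tripleKernel s^T = transpose (tripleKernel s).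
Proof.
by apply: funext => a; apply: funext => b; rewrite /tripleKernel !mxE.
Qed.

Lemma tripleKernel1 (a b : triple n) :
  tripleKernel (1%:M : 'M[R]_n) a b = (a == b)%:R.
Proof.
by rewrite /tripleKernel !mxE -!natrM !mulnb -!xpair_eqE -!surjective_pairing.
Qed.

Lemma orthogonal1 : orthogonalGroup (1%:M : 'M[R]_n).
Proof. by rewrite /orthogonalGroup /= trmx1 mulmx1. Qed.

Lemma orthogonal_tr s : orthogonalGroup s -> orthogonalGroup s^T.
Proof. by rewrite /orthogonalGroup /= trmxK => /mulmx1C. Qed.

Lemma orthogonalN s : orthogonalGroup s -> orthogonalGroup (- s).
Proof. by rewrite /orthogonalGroup /= linearN/= mulmxN mulNmx opprK. Qed.

Lemma orthogonal_mul s t :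
  orthogonalGroup s -> orthogonalGroup t -> orthogonalGroup (s *m t).
Proof.
rewrite /orthogonalGroup /= => os ot.
by rewrite trmx_mul mulmxA -(mulmxA s) ot mulmx1.
Qed.

Lemma tripleKernel_orthogonal s :
  orthogonalGroup s -> orthogonalKernel (tripleKernel s).
Proof.
by move=> os a b; rewrite -tripleKernel1 -os -tripleKernel_mul tripleKernel_tr.
Qed.

Lemma act1 x : act 1%:M x = x.
Proof.
apply/ffunP => a; rewrite actE -[RHS]/((x : _ -> R) a) -(app_delta x).
by apply: eq_bigr => b _; rewrite tripleKernel1 app_delta.
Qed.

Lemma act_mul s t x : act s (act t x) = act (s *m t) x.
Proof.
apply/ffunP => a; rewrite !actE app_app.
by apply: eq_bigr => b _; rewrite tripleKernel_mul.
Qed.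

Lemma dot_act s x y : dot (act s x) y = dot x (act s^T y).
Proof. by rewrite !actE dot_app tripleKernel_tr. Qed.

Lemma dot_act_act s x y :
  orthogonalGroup s -> dot (act s x) (act s y) = dot x y.
Proof. by move=> os; rewrite dot_act act_mul (mulmx1C os) act1. Qed.

(** The action is cubic in [s], and three is odd. *)
Lemma dot_actN s x y : dot (act (- s) x) y = - dot (act s x) y.
Proof.
rewrite !actE /dot -sumrN; apply: eq_bigr => a _; rewrite -mulNr; congr (_ * _).
rewrite /app -sumrN; apply: eq_bigr => b _; rewrite /tripleKernel !mxE; ring.
Qed.

(** Matrices are parametrized by functions on pairs, which carry the product topology used by
    Tychonoff's theorem. *)
Definition matrixOf (f : 'I_n * 'I_n -> R) : 'M[R]_n := \matrix_(i, j) f (i, j).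

(** Orthonormality of the rows is a family of closed conditions, and unit rows have entries in
    [-1, 1]. *)
Lemma orthogonal_compact :
  compact [set f | orthogonalGroup (matrixOf f)].
Proof.
apply: subclosed_compact _ (@cube_compact R _ 1) _.
  pose Z (p : 'I_n * 'I_n) := [set f : 'I_n * 'I_n -> R |
    \sum_k f (p.1, k) * f (p.2, k) = (p.1 == p.2)%:R].
  rewrite (_ : mkset _ = \bigcap_p Z p).
    apply: closed_bigI => p _.
    apply: (@closed_comp _ _
      (fun f : 'I_n * 'I_n -> R => \sum_k f (p.1, k) * f (p.2, k))
      [set t | t = (p.1 == p.2)%:R]); last exact: closed_eq.
    move=> f _; apply: sum_continuous => k.
    by apply: mul_fun_continuous; exact: coordinate_continuous.
  apply/seteqP; split => f /=.
    move=> /matrixP of_ [i j] _; have := of_ i j; rewrite !mxE => ofij.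
    by apply: etrans ofij; apply: eq_bigr => k _; rewrite !mxE.
  move=> of_; apply/matrixP => i j; rewrite !mxE; apply: etrans (of_ (i, j) I).
  by apply: eq_bigr => k _; rewrite !mxE.
move=> f /= /matrixP of_ [i j]; rewrite /= in_itv/=.
have fij : f (i, j) * f (i, j) <= 1.
  have := of_ i i; rewrite !mxE eqxx => ofii; rewrite -[leRHS]ofii.
  under eq_bigr do rewrite !mxE.
  rewrite (bigD1 j)//= lerDl.
  by apply: sumr_ge0 => k _; rewrite -expr2 sqr_ge0.
by nra.
Qed.

Lemma dot_act_continuous x y :
  continuous (fun f => dot (act (matrixOf f) x) y).
Proof.
rewrite (_ : (fun f => _) = fun f => \sum_a (\sum_b
  (f (a.1.1, b.1.1) * f (a.1.2, b.1.2) * f (a.2, b.2)) * x b) * y a);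
  last first.
  apply: funext => f; rewrite actE; apply: eq_bigr => a _; congr (_ * _).
  by apply: eq_bigr => b _; rewrite /tripleKernel !mxE.
apply: sum_continuous => a; apply: mul_fun_continuous; last first.
  exact: cst_continuous.
apply: sum_continuous => b; apply: mul_fun_continuous; last first.
  exact: cst_continuous.
by do 2?apply: mul_fun_continuous; exact: coordinate_continuous.
Qed.

Lemma matrixOfK s : matrixOf (fun p => s p.1 p.2) = s.
Proof. by apply/matrixP => i j; rewrite mxE. Qed.

(* By compactness, [<act s x1, x0>] is bounded by some [c1 < <x1, x1>], and so
   is its absolute value because [- s] acts as the opposite of [s]. High even
   powers of the inner products with a finite net of the orbit of [x1] then tell
   the two orbits apart. *)
Lemma separating_power_sum x0 x1 :
  dot x0 x0 <= dot x1 x1 -> (forall s, orthogonalGroup s -> act s x1 <> x0) ->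
  exists d (w : {ffun 'I_d -> triple n} -> R) (a b : R),
    a < b /\ forall s, orthogonalGroup s ->
      dot w (tensorPower (act s x0)) <= a /\
      b <= dot w (tensorPower (act s x1)).
Proof.
move=> x01 disj.
pose O := [set f | orthogonalGroup (matrixOf f)].
have O0 : O !=set0.
  exists (fun p => 1%:M p.1 p.2); rewrite /O /= matrixOfK.
  exact: orthogonal1.
have cO : {within O, continuous (fun f => dot (act (matrixOf f) x1) x0)}.
  by apply: continuous_subspaceT => f; exact: dot_act_continuous.
have [f0 /set_mem Of0 f0max] := compact_EVT_max O0 (@orthogonal_compact) cO.
set c1 := dot (act _ x1) x0 in f0max.
have max_c1 s : orthogonalGroup s -> dot (act s x1) x0 <= c1.
  move=> os; have := f0max (fun p => s p.1 p.2); rewrite matrixOfK; apply.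
  by apply/mem_set; rewrite /O /= matrixOfK.
have norm_c1 s : orthogonalGroup s -> `|dot (act s x1) x0| <= c1.
  move=> os; rewrite ler_norml max_c1// andbT lerNl -dot_actN max_c1//.
  exact: orthogonalN.
have c1_ge0 : 0 <= c1 by apply: le_trans (norm_c1 _ orthogonal1).
(* Otherwise, at the maximizer [f0], the squared distance from [x0] to the image of [x1] is at most
   [dot x0 x0 - dot x1 x1 <= 0], so [x0] is in the orbit of [x1]. *)
have c1_lt : c1 < dot x1 x1.
  rewrite ltNge; apply/negP => c1_ge; apply: (disj _ Of0).
  apply/ffunP => a; apply/eqP; rewrite -subr_eq0; apply/eqP.
  move: a; apply: (@dot_le0_eq0 _ _ (fun a => act _ x1 a - x0 a)).
  by rewrite dot_subsq dot_act_act// -/c1; lra.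
pose c := (c1 + dot x1 x1) / 2.
have c1_lt_c : c1 < c by rewrite /c; lra.
have c_gt0 : 0 < c by apply: le_lt_trans c1_lt_c.
(* Each orthogonal [s] lies in its own [U s], since [dot (act s x1) (act s x1) = dot x1 x1 > c]. *)
pose U s := [set f | c < dot (act (matrixOf f) x1) (act s x1)].
have openU s : orthogonalGroup s -> open (U s).
  move=> _; apply: (@open_comp _ _
    (fun f => dot (act (matrixOf f) x1) (act s x1)) [set t | c < t]).
    by move=> f _; exact: dot_act_continuous.
  exact: open_gt.
have cover_U : O `<=` cover (@orthogonalGroup R n) U.
  move=> f Of; exists (matrixOf f) => //; rewrite /U /= dot_act_act// /c.
  by lra.
have : cover_compact O by exact/fun_compact_cover/orthogonal_compact.
move=> /(_ _ _ _ openU cover_U)[D' sub_D' covD'].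
(* This says [#|D'| * c1 ^+ d < c ^+ d], the desired gap. Evenness of [d] makes all the powers
   nonnegative. *)
have [d even_d small_d] : exists2 d, ~~ odd d & #|`D'|%:R * (c1 / c) ^+ d < 1.
  have q_lt1 : `|c1 / c| < 1.
    rewrite normf_div (ger0_norm c1_ge0) (gtr0_norm c_gt0).
    by rewrite ltr_pdivrMr ?mul1r.
  have : #|`D'|%:R * (c1 / c) ^+ d @[d --> \oo] --> (#|`D'|%:R * 0 : R).
    by apply: cvgM; [exact: cvg_cst|exact: cvg_expr].
  rewrite mulr0 => /cvgr_lt /(_ 1 ltr01)[N _ smallN].
  exists N.*2; first by rewrite odd_double.
  by apply: smallN; rewrite /= -addnn leq_addr.
exists d, (fun phi => \sum_(s <- D') tensorPower (act s x1) phi).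
exists (#|`D'|%:R * c1 ^+ d), (c ^+ d); split.
  by move: small_d; rewrite expr_div_n mulrA ltr_pdivrMr ?exprn_gt0// mul1r.
have dotE y : dot (fun phi => \sum_(s <- D') tensorPower (act s x1) phi)
    (tensorPower (d := d) y) = \sum_(s <- D') dot (act s x1) y ^+ d.
  rewrite /dot; under eq_bigr do rewrite mulr_suml.
  by rewrite exchange_big; apply: eq_bigr => s _; exact: dot_tensorPower.
have pow_ge0 (t : R) : 0 <= t ^+ d by exact: exprn_even_ge0.
move=> s os; rewrite !dotE; split.
  (* Upper bound: moving [s] across the inner product shows that each of the [#|D'|] terms is at
     most [c1 ^+ d]. *)
  rewrite -sum1_size natr_sum mulr_suml big_seq [leRHS]big_seq.
  apply: ler_sum => t /sub_D' /set_mem ot; rewrite mul1r.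
  rewrite dotC dot_act act_mul dotC -[leLHS]ger0_norm// normrX.
  apply: lerXn2r; rewrite ?nnegrE//; apply: norm_c1.
  exact: orthogonal_mul (orthogonal_tr os) ot.
(* Lower bound: some [U t] of the finite subcover contains [s]. Its term alone is at least
   [c ^+ d]. *)
have [|t tD'] := covD' (fun p => s p.1 p.2); first by rewrite /O /= matrixOfK.
rewrite /U /= matrixOfK => c_lt.
rewrite (big_fsetD1 t)//= dotC.
apply: le_trans (_ : _ <= dot (act s x1) (act t x1) ^+ d) _.
  by apply: lerXn2r; rewrite ?nnegrE ?ltW// (lt_trans c_gt0).
by rewrite lerDl; apply: sumr_ge0.
Qed.

Lemma separating_invariant x0 x1 :
  (forall s, orthogonalGroup s -> act s x1 <> x0) ->
  exists2 f, polynomialInvariantOn (@orthogonalGroup R n) setT f & f x0 <> f x1.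
Proof.
(* Disjointness of the two orbits is symmetric, by inverting [s]. *)
wlog x01 : x0 x1 / dot x0 x0 <= dot x1 x1.
  move=> wlog_x01 disj.
  have [/wlog_x01|/ltW/wlog_x01] := leP (dot x0 x0) (dot x1 x1); first exact.
  case=> [s os x0_x1|f f_inv neq]; last by exists f => // /esym.
  apply: (disj _ (orthogonal_tr os)).
  by rewrite -x0_x1 act_mul (mulmx1C os) act1.
move=> disj; have [d [w0 [a [b [ab sep0]]]]] := separating_power_sum x01 disj.
pose C := [set w : {ffun 'I_d -> triple n} -> R |
  forall s, orthogonalGroup s ->
    dot w (tensorPower (act s x0)) <= a /\
    b <= dot w (tensorPower (act s x1))].
have closedC : closed C.
  rewrite (_ : C = \bigcap_(s in @orthogonalGroup R n)
    ([set w | dot w (tensorPower (act s x0)) <= a] `&`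
     [set w | b <= dot w (tensorPower (act s x1))])).
    apply: closed_bigI => s _; apply: closedI.
      exact: closed_halfspace_le.
    exact: closed_halfspace_ge.
  by apply/seteqP; split => w Cw s /Cw.
have midC u v : C u -> C v -> C (fun k => (u k + v k) / 2).
  move=> Cu Cv s os; rewrite !dot_midpoint.
  by have [? ?] := Cu s os; have [? ?] := Cv s os; split; lra.
have [w Cw w_fixed] := exists_fixed_vector (ex_intro _ w0 sep0) closedC midC.
(* [C] is stable under the group: moving the kernel to the other side of the inner product replaces
   [t] by [s^T *m t], again orthogonal. *)
have w_inv s : orthogonalGroup s -> app (kernelPower (tripleKernel s)) w = w.
  move=> os; apply: w_fixed => [|v Cv t ot].
    rewrite kernelPower_transpose -tripleKernel_tr.
    exact/kernelPower_orthogonal/tripleKernel_orthogonal/orthogonal_tr.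
  rewrite !dot_app.
  have tE x : app (transpose (kernelPower (d := d) (tripleKernel s)))
      (tensorPower (act t x)) = tensorPower (act (s^T *m t) x).
    rewrite kernelPower_transpose -act_mul (actE s^T) tripleKernel_tr.
    exact: app_tensorPower.
  by rewrite !tE; apply: Cv; apply: orthogonal_mul => //; exact: orthogonal_tr.
exists (fun x => dot w (tensorPower x)); last first.
  have [+ +] := Cw _ orthogonal1; rewrite !act1 => le_a ge_b eq_x.
  rewrite eq_x in le_a; move: ab; rewrite ltNge => /negP; apply.
  exact: le_trans le_a.
split=> [|s x os _]; last first.
  rewrite actE -app_tensorPower dotC dot_app dotC.
  rewrite kernelPower_transpose -tripleKernel_tr w_inv//.
  exact: orthogonal_tr.
(* One monomial per multi-index [phi], with coefficient [w phi]. *)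
exists (\sum_phi mpoly.mpolyC #|{: triple n}| (w phi) *
  \prod_i mpoly.mpolyX R (mpoly.mnm1 (enum_rank (phi i)))) => x _.
rewrite rmorph_sum; apply: eq_bigr => phi _.
rewrite rmorphM rmorph_prod/= mpoly.mevalC; congr (_ * _).
by apply: eq_bigr => i _; rewrite mpoly.mevalXU enum_rankK.
Qed.

End OrthogonalAction.

(** * Membership in the orbit union, decided by the invariants *)

Theorem theorem5p1 (R : realType) (n : nat)
  (m : nat) (I : 'I_m -> tensor R n -> R)
  (I_gen : generatingFamily (@orthogonalGroup R n) (@symTensor R n) I)
  (r : nat) (D : set 'rV[R]_r) (rho : 'rV[R]_r -> tensor R n)
  (A : set (tensor R n)) (A_param : A = [set rho v | v in D])
  (A_sym : A `<=` @symTensor R n)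
  (l : nat) (q : 'I_l -> tensor R n -> R)
  (q_gen : generatingFamily (stabilizer A) A q)
  (T : set (tensor R n)) (T_inv : invariantSet T)
  (S_sub_T : orbitUnion A `<=` T) (T_sym : T `<=` @symTensor R n)
  (qt : 'I_l -> tensor R n -> R)
  (qt_inv : forall j, invariantOn (@orthogonalGroup R n) T (qt j))
  (qt_q : forall j G, A G -> qt j G = q j G)
  (F : 'I_m -> mpoly.mpoly l R)
  (F_I : forall i G, A G -> I i G = mpoly.meval (fun j => q j G) (F i))
  (G : tensor R n) (G_sym : symTensor G) :
  orbitUnion A G <->
  (T G /\ forall i, I i G = mpoly.meval (fun j => qt j G) (F i)) /\
  (exists2 G0, A G0 & forall j, qt j G = qt j G0).
Proof.
have T_A G0 : A G0 -> T G0.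
  move=> AG0; apply: S_sub_T; exists 1%:M, G0; split => //.
    exact: orthogonal1.
  by rewrite act1.
split=> [|[[TG I_F] [G0 AG0 qt_eq]]].
  move=> [s [G0 [os AG0 GE]]].
  have qtE j : qt j G = q j G0.
    by rewrite GE (qt_inv j s G0 os (T_A G0 AG0)) qt_q.
  split; last by exists G0 => // j; rewrite qtE qt_q.
  split=> [|i]; first by apply: S_sub_T; exists s, G0.
  have [_ /(_ s G0 os (A_sym G0 AG0)) I_inv] := I_gen.1 i.
  by rewrite [in LHS]GE I_inv F_I//; apply: mpoly.meval_eq => j; rewrite qtE.
have I_eq i : I i G = I i G0.
  by rewrite I_F F_I//; apply: mpoly.meval_eq => j; rewrite qt_eq qt_q.
(* If [G] were outside the orbit of [G0], some invariant polynomial [f] would separate them. On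
   symmetric tensors [f] is a polynomial in the [I i], which agree at [G] and [G0]. *)
apply: contrapT => notS.
have [|f [[p fp] f_inv] neq] := @separating_invariant R n G G0.
  by move=> s os sG0; apply: notS; exists s, G0; split.
have f_sym : polynomialInvariantOn (@orthogonalGroup R n) (@symTensor R n) f.
  by split=> [|s x os _]; [exists p => x _; exact: fp|exact: f_inv].
have [P fP] := I_gen.2 f f_sym.
by apply: neq; rewrite !fP//; [exact: mpoly.meval_eq|exact: A_sym].
Qed.
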